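(* Let $k$ and $i$ be fixed positive integers with $1\leq i\leq k+1$. Then for every positive integer $n$, \[ \overline{\eta}_{2k-1}(n)=\sum_{m=1}^{\infty}\binom{m+k-1}{2k-1}N(m,n) \] is equal to the number of $(k+1)$-marked Durfee symbols $\tau$ of $n$ whose $i$-th rank $\rho_i(\tau)$ equals $0$.
   Context: A partition $\lambda=(\lambda_1,\ldots,\lambda_s)$ has parts $\lambda_1\ge\cdots\ge\lambda_s\ge1$; $\ell(\lambda)=s$ is its number of parts and $|\lambda|$ its sum. The rank of a partition is its largest part minus its number of parts, and $N(m,n)$ denotes the number of partitions of $n$ with rank $m$. For a positive integer $k$, a $k$-marked Durfee symbol of $n$ is an array $\tau=\begin{pmatrix}\alpha^k,&\alpha^{k-1},&\ldots,&\alpha^1\\ \beta^k,&\beta^{k-1},&\ldots,&\beta^1\end{pmatrix}_D$ consisting of $k$ pairs $(\alpha^j,\beta^j)$ of partitions and a positive integer $D$ such that: (1) $\alpha^j$ is nonempty for $1\le j<k$, while $\alpha^k$ and all $\beta^j$ may be empty; (2) for $2\le j\le k$, $\beta^{j-1}_1\le\alpha^{j-1}_1\le\min\{\alpha^j_s,\beta^j_s\}$, where $\alpha^j_s,\beta^j_s$ denote the smallest parts of $\alpha^j,\beta^j$ (the minimum taken over those that are nonempty), and $\beta^{j-1}_1$ is the largest part of $\beta^{j-1}$ (condition vacuous if empty); (3) the largest parts $\alpha^k_1,\beta^k_1$ are at most $D$; (4) $\sum_{j=1}^k(|\alpha^j|+|\beta^j|)+D^2=n$. The $j$-th rank of $\tau$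 is $\rho_j(\tau)=\ell(\alpha^j)-\ell(\beta^j)-1$ for $1\le j<k$ and $\rho_k(\tau)=\ell(\alpha^k)-\ell(\beta^k)$.
   Formalization: When the last pair of the symbol is empty on both sides, the minimum in condition (2) is taken to be D, so the largest part of the preceding α must be at most D; with no bound there the claim fails, e.g. for k=1, i=2, n=3 (2 versus 3 symbols). *)

(* Defs.v *)
From mathcomp Require Import all_boot all_algebra finmap zify.
From mathcomp Require Import boolp classical_sets functions cardinality fsbigop.

Set Implicit Arguments.
Unset Strict Implicit.
Unset Printing Implicit Defensive.

Import GRing.Theory.

Local Open Scope nat_scope.
Local Open Scope classical_set_scope.

(* A partition is the weakly decreasing list of its positive parts. *)
Definition is_partition (la : seq nat) : bool :=
  sorted geq la && all (leq 1) la.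

(* Both are 0 on the empty partition. *)
Definition largest (la : seq nat) : nat := head 0 la.
Definition smallest (la : seq nat) : nat := last 0 la.

Definition rank (la : seq nat) : int := ((largest la)%:Z - (size la)%:Z)%R.

(* [fset_set] of an infinite set is empty; the sets counted below are finite,
   see [finite_rank_set] and [finite_marked_durfee]. *)
Definition count_set (T : choiceType) (A : set T) : nat := #|` fset_set A|.

Definition N (m : int) (n : nat) : nat :=
  count_set [set la : seq nat |
    [/\ is_partition la, sumn la = n & rank la = m]].

(* The index of the moment is 2k-1.  The sum is a finite-support sum over all
   m >= 1; its support is finite by [N_eq0]. *)
Definition eta_bar_odd (k n : nat) : nat :=
  \big[addn/0]_(m \in [set m : nat | 1 <= m])
    ('C(m + k - 1, 2 * k - 1) * N m%:Z n).

(* The pairs (alpha^1, beta^1), ..., (alpha^k, beta^k), in this order (the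
   array displays them from right to left), followed by the subscript D. *)
Definition symbol (k : nat) : choiceType :=
  (k.-tuple (seq nat * seq nat) * nat)%type.

(* Superscripts j start at 1. *)
Definition alpha (k : nat) (tau : symbol k) (j : nat) : seq nat :=
  (nth ([::], [::]) tau.1 j.-1).1.
Definition beta (k : nat) (tau : symbol k) (j : nat) : seq nat :=
  (nth ([::], [::]) tau.1 j.-1).2.
Definition side (k : nat) (tau : symbol k) : nat := tau.2.

(* The minimum of the smallest parts of those of alpha^j, beta^j that are
   nonempty.  If both are empty (possible only for j = k) it is D: every part
   of a k-marked Durfee symbol is at most D, even when the k-th pair is empty.
   For the same reason D does not affect the minimum in the other cases. *)
Definition min_part (k : nat) (tau : symbol k) (j : nat) : nat :=
  \big[minn/side tau]_(la <- [:: alpha tau j; beta tau j] | la != [::])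
    smallest la.

Record is_marked_durfee (k n : nat) (tau : symbol k) : Prop := {
  durfee_side_gt0 : 0 < side tau;
  durfee_partitions : forall j, 1 <= j <= k ->
    is_partition (alpha tau j) && is_partition (beta tau j);
  durfee_nonempty : forall j, 1 <= j < k -> alpha tau j <> [::];
  durfee_chain : forall j, 2 <= j <= k ->
    largest (beta tau j.-1) <= largest (alpha tau j.-1) <= min_part tau j;
  durfee_bound :
    largest (alpha tau k) <= side tau /\ largest (beta tau k) <= side tau;
  durfee_weight :
    \sum_(1 <= j < k.+1) (sumn (alpha tau j) + sumn (beta tau j))
      + side tau ^ 2 = n
}.

Definition rho (k : nat) (tau : symbol k) (j : nat) : int :=
  if j < k then ((size (alpha tau j))%:Z - (size (beta tau j))%:Z - 1)%R
  else ((size (alpha tau j))%:Z - (size (beta tau j))%:Z)%R.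

Lemma finite_partition n :
  finite_set [set la : seq nat | is_partition la /\ sumn la <= n].
Proof.
pose f (s : n.-bseq 'I_n.+1) := [seq val i | i <- s].
apply: (@sub_finite_set _ _ (range f)); last exact/finite_image/finite_finset.
move=> la [/andP[_ la_gt0] la_n] /=.
have [sz_la le_la] : size la <= n /\ all (fun x => x < n.+1) la.
  elim: la n la_gt0 la_n {f} => [|x s IHs] n //= /andP[x_gt0 s_gt0] xs_n.
  have [//|sz_s _] := IHs (n - x) s_gt0; first by lia.
  have [//|_ s_n] := IHs n s_gt0; first by lia.
  by rewrite s_n andbT; split; lia.
have sz : size [seq (inord i : 'I_n.+1) | i <- la] <= n by rewrite size_map.
exists (Bseq sz) => //; rewrite /f /= -map_comp -[RHS]map_id.
by apply/eq_in_map => i /(allP le_la) i_n /=; rewrite inordK.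
Qed.

Lemma finite_rank_set (m : int) n :
  finite_set [set la : seq nat |
    [/\ is_partition la, sumn la = n & rank la = m]].
Proof.
by apply: sub_finite_set (finite_partition n) => la [la_p <- _]; split.
Qed.

Lemma N_eq0 (m n : nat) : n < m -> N m%:Z n = 0.
Proof.
move=> lt_nm; rewrite /N /count_set.
set A := (X in fset_set X); suff -> : A = set0 by rewrite fset_set0 cardfs0.
rewrite -subset0 => la [_ sum_la]; rewrite /rank /largest.
have : head 0 la <= n by rewrite -sum_la; case: (la) => //= x s; lia.
lia.
Qed.

Lemma finite_marked_durfee (k n : nat) :
  finite_set [set tau : symbol k | is_marked_durfee n tau].
Proof.
pose P := [set la : seq nat | is_partition la /\ sumn la <= n].
have /finite_seqP[s Ps] : finite_set P := finite_partition n.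
pose T := seq_sub s.
pose f (u : k.-tuple (T * T) * 'I_n.+1) : symbol k :=
  ([tuple of [seq (val p.1, val p.2) | p <- u.1]], val u.2).
apply: (@sub_finite_set _ _ (range f)); last exact/finite_image/finite_finset.
move=> [t D] [/= D_gt0 t_part _ _ _ t_n].
have mem_t (i : 'I_k) : ((tnth t i).1 \in s) && ((tnth t i).2 \in s).
  have [] : P (tnth t i).1 /\ P (tnth t i).2.
    have := t_part i.+1 (ltn_ord i).
    rewrite /alpha /beta /= -!tnth_nth => /andP[pa pb].
    have : sumn (tnth t i).1 + sumn (tnth t i).2 <= n.
      rewrite -t_n big_add1 big_mkord (bigD1 i) //= /alpha /beta /=.
      by rewrite -!tnth_nth -!addnA addnA leq_addr.
    move=> le_n; split; split=> //; apply: leq_trans le_n.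
      exact: leq_addr.
    exact: leq_addl.
  by rewrite !Ps /= => -> ->.
have D_n : D < n.+1.
  rewrite ltnS -t_n /side /=; apply: leq_trans (leq_addl _ _).
  by rewrite expnS expn1 leq_pmull.
pose g (i : 'I_k) : T * T :=
  (SeqSub (andP (mem_t i)).1, SeqSub (andP (mem_t i)).2).
exists ([tuple g i | i < k], Ordinal D_n) => //; congr pair.
apply: eq_from_tnth => i; rewrite tnth_map tnth_mktuple /g /=.
by case: (tnth t i).
Qed.

(* Main.v *)
(* Splitting alpha^j (j < k+1) into its first part a_j and the remaining parts
   shows that, with z_j marking the j-th rank, the symbols with D fixed have the
   generating function
     sum over 1 <= a_1 <= ... <= a_k <= D of
       q^(a_1 + ... + a_k) F(1, a_1; z_1) F(a_1, a_2; z_2) ...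
         F(a_k, D; z_(k+1))
   times q^(D^2), where F(a, b; z) is the product of
   1 / ((1 - z q^p) (1 - q^p / z)) over a <= p <= b.  This sum is the divided
   difference of F(1, D; z), as a function of u = z + 1/z, at the points
   u_1, ..., u_(k+1); hence it is symmetric in the z_j, and for z_1 = z and all
   other z_j = 1 it arises from F(1, D; z) by k-fold application of
   f |-> (f(z) - f(1)) / (z - 2 + 1/z).  On coefficients this inverts the second
   difference k times, and the kernel of the inverse at 0 is
   m |-> 'C(m + k - 1, 2k - 1).  Finally, q^(D^2) F(1, D; z), summed over D,
   generates N(m, n) by dissection at the Durfee square.  Both facts on divided
   differences follow from the recurrence in k and D for the coefficients. *)

Require Import Defs.
From mathcomp Require Import all_boot all_algebra finmap zify.
From mathcomp Require Import boolp classical_sets functions cardinality fsbigop.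

Set Implicit Arguments.
Unset Strict Implicit.
Unset Printing Implicit Defensive.

Import GRing.Theory.

Local Open Scope nat_scope.
Local Open Scope classical_set_scope.

(** * Cardinals of finite sets *)

Lemma count_set_bij (T U : choiceType) (f : T -> U) (A : set T) (B : set U) :
  finite_set A -> (forall x y, A x -> A y -> f x = f y -> x = y) ->
  (forall x, A x -> B (f x)) -> (forall y, B y -> exists2 x, A x & f x = y) ->
  count_set B = count_set A.
Proof.
move=> finA inj_f fAB surj_f.
have -> : B = f @` A.
  apply/seteqP; split=> [y /surj_f[x Ax <-]|_ [x Ax <-]]; last exact: fAB.
  by exists x.
rewrite /count_set fset_set_image // card_in_imfset // => x y.
by rewrite !in_fset_set // !inE; apply: inj_f.
Qed.

Lemma count_setU_disj (T : choiceType) (A B C : set T) :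
  finite_set A -> finite_set B -> (forall x, A x -> ~ B x) ->
  (forall x, C x <-> A x \/ B x) -> count_set C = count_set A + count_set B.
Proof.
move=> finA finB disAB CAB; have -> : C = A `|` B.
  by apply/seteqP; split=> x /CAB.
rewrite /count_set fset_setU // cardfsU [X in _ - X](_ : _ = 0) ?subn0 //.
apply/eqP; rewrite cardfs_eq0 -fset_setI //; apply/eqP.
rewrite [X in fset_set X](_ : _ = set0) ?fset_set0 //.
by rewrite -subset0 => x [/disAB].
Qed.

Lemma count_set_eq0 (T : choiceType) (A : set T) :
  (forall x, ~ A x) -> count_set A = 0.
Proof.
move=> A0; have -> : A = set0 by rewrite -subset0 => x /A0.
by rewrite /count_set fset_set0 cardfs0.
Qed.

Lemma count_set_fibers (T : choiceType) (A : set T) (f : T -> nat) n :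
  finite_set A -> (forall x, A x -> f x < n) ->
  count_set A = \sum_(d < n) count_set [set x | A x /\ f x = d].
Proof.
elim: n A => [|n IHn] A finA f_lt.
  by rewrite big_ord0 count_set_eq0 // => x /f_lt.
have subA (B : set T) : (B `<=` A) -> finite_set B.
  by move=> BA; apply: sub_finite_set finA.
rewrite big_ord_recr /= (@count_setU_disj _ [set x | A x /\ f x < n]
  [set x | A x /\ f x = n]); first last.
- move=> x; split=> [Ax|[[]|[]] //].
  by have := f_lt x Ax; rewrite ltnS leq_eqVlt => /predU1P[]; [right|left].
- by move=> x [_ /= lt_x] [_ /= eq_x]; lia.
- by apply: subA => x [].
- by apply: subA => x [].
rewrite IHn; last by move=> x [].
  congr (_ + _); apply: eq_bigr => d _; congr count_set.
  apply/seteqP; split=> x [/=]; first by move=> [].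
  by move=> Ax fx; split=> //; split=> //=; rewrite fx ltn_ord.
by apply: subA => x [].
Qed.

(** * Chains *)

(* A symbol is encoded as the sequence, top pair first, of the triples
   (d, (a, b)) where d = D, a = alpha^k for the top pair and d is the first part
   of alpha^j, a the rest of alpha^j for j < k; b = beta^j throughout.  The j-th
   rank is then size a - size b for every j. *)
Definition chain : choiceType := seq (nat * (seq nat * seq nat)).

(** On the empty chain, the value 0 adds nothing to the weight, while the value 1 of [low] is the
    lower bound for the parts in the bottom pair. *)
Definition top (c : chain) := if c is (d, _) :: _ then d else 0.
Definition low (c : chain) := if c is (d, _) :: _ then d else 1.

Definition parts_in (l d : nat) (s : seq nat) : bool :=
  sorted geq s && all (fun x => l <= x <= d) s.

(* A single pair may have [top c = 0]: this is the base case D = 0 of the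
   recurrence. *)
Fixpoint valid (c : chain) : bool :=
  if c is (d, (a, b)) :: c' then
    [&& parts_in (low c') d a, parts_in (low c') d b, 0 < low c' &
        (c' == [::]) || (low c' <= d) && valid c']
  else false.

(* [top c] is not counted. *)
Fixpoint weight (c : chain) : nat :=
  if c is (d, (a, b)) :: c' then sumn a + sumn b + (top c' + weight c') else 0.

(* Positions are counted from 1 at the bottom of the chain; the value is 0 for
   i = 0 and for i > size c, so that i = 0 and rank 0 impose no condition. *)
Fixpoint crank (i : nat) (c : chain) : int :=
  if c is (_, (a, b)) :: c' then
    if i == (size c').+1 then ((size a)%:Z - (size b)%:Z)%R else crank i c'
  else 0%R.

Definition chains (i k D : nat) (j : int) (n : nat) : set chain :=
  [set c | [/\ valid c, size c = k.+1, top c = D, crank i c = j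
             & weight c = n]].

Definition nb_chains (i k D : nat) (j : int) (n : nat) : nat :=
  count_set (chains i k D j n).

(** * Finiteness of the sets of chains *)

Lemma parts_inW l d s : 0 < l -> parts_in l d s -> is_partition s.
Proof.
move=> l_gt0 /andP[s_s /allP lsd]; apply/andP; split=> //.
by apply/allP => x /lsd /andP[lx _]; apply: leq_trans lx.
Qed.

Lemma size_parts l d s : 0 < l -> parts_in l d s -> size s <= sumn s.
Proof.
move=> l_gt0 /andP[_]; elim: s => //= x s IHs /andP[/andP[lx _] /IHs]; lia.
Qed.

Lemma finite_seqs (T : choiceType) (A : set T) k : finite_set A ->
  finite_set [set s : seq T | size s = k /\ forall x, x \in s -> A x].
Proof.
move=> finA; elim: k => [|k IHk].
  by apply: sub_finite_set (finite_set1 [::]) => s [/size0nil ->].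
apply: (@sub_finite_set _ _ ((fun u : T * seq T => u.1 :: u.2) @`
  (A `*` [set s : seq T | size s = k /\ forall x, x \in s -> A x]))).
  move=> [|x s] [] //= [sz_s] inA; exists (x, s) => //; split=> /=.
    by apply: inA; rewrite mem_head.
  by split=> // y ys; apply: inA; rewrite inE ys orbT.
by apply: finite_image; apply: finite_setX.
Qed.

(** An entry d is either the top or one of the tops counted by [weight]; so bounding top and weight
    leaves finitely many possible entries. *)
Lemma valid_cell c d a b : valid c -> (d, (a, b)) \in c ->
  [/\ is_partition a, is_partition b, sumn a + sumn b <= weight c
    & d <= top c + weight c].
Proof.
elim: c => [|[d' [a' b']] c IHc] //= /and4P[pa pb l0 vc].
rewrite inE => /predU1P[[-> -> ->]|in_c].
  by split; rewrite ?(parts_inW l0 pa) ?(parts_inW l0 pb) //; lia.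
have vc' : valid c by case: (c) vc in_c => //= ? ? /andP[].
by have [-> -> ? ?] := IHc vc' in_c; split=> //; lia.
Qed.

Lemma finite_chains_le k M :
  finite_set
    [set c : chain | [/\ valid c, size c = k.+1 & top c + weight c <= M]].
Proof.
pose P := [set la : seq nat | is_partition la /\ sumn la <= M].
have finP : finite_set P := finite_partition M.
apply: (@sub_finite_set _ _ [set c : chain | size c = k.+1 /\
  forall x, x \in c -> (`I_M.+1 `*` (P `*` P)) x]).
  move=> c [vc sc wc]; split=> // -[d [a b]] /(valid_cell vc)[pa pb sab ld].
  by do !split=> //=; lia.
apply: finite_seqs; apply: finite_setX; first exact: finite_II.
exact: finite_setX.
Qed.

Lemma finite_chains i k D j n : finite_set (chains i k D j n).
Proof.
apply: sub_finite_set (finite_chains_le k (D + n)) => c [vc sc <- _ <-].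
by split.
Qed.

Lemma sub_chains_finite (A : set chain) i k D j n :
  A `<=` chains i k D j n -> finite_set A.
Proof. by move=> /sub_finite_set; apply; apply: finite_chains. Qed.

Lemma parts_in_cons l d s : parts_in l d (d :: s) = (l <= d) && parts_in l d s.
Proof.
rewrite /parts_in /= path_sortedE; last by move=> x y z /=; lia.
rewrite leqnn andbT; apply/idP/idP.
  by case/and3P=> /andP[_ ->] -> ->.
case/and3P=> -> -> lsd; rewrite lsd !andbT; apply/allP => x /(allP lsd).
by case/andP.
Qed.

Lemma parts_inS l D s :
  parts_in l D.+1 s && (head 0 s != D.+1) = parts_in l D s.
Proof.
case: s => [|x s]; first by rewrite /parts_in.
rewrite /parts_in /= path_sortedE; last by move=> ? ? ? /=; lia.
apply/idP/idP.
  case/andP=> /and3P[/andP[sx ss] lx sl] x_neq; rewrite sx ss /=.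
  apply/andP; split; first by move: lx x_neq; lia.
  apply/allP => y ys; have /= := allP sx y ys; have /= := allP sl y ys.
  by move: lx x_neq; lia.
case/and3P=> /andP[-> ->] lx sl /=; apply/andP; split; last by move: lx; lia.
apply/andP; split; first by move: lx; lia.
by apply/allP => y /(allP sl) /=; lia.
Qed.

(** * Recurrences *)

(** Serves to peel off one part or one pair: [f] puts it back, and [B] holds the objects not
    obtained in this way. *)
Lemma count_set_step (T : choiceType) (f : T -> T) (A B C : set T) :
  finite_set A -> finite_set B ->
  (forall x y, A x -> A y -> f x = f y -> x = y) ->
  (forall x, A x -> C (f x) /\ ~ B (f x)) -> (forall x, B x -> C x) ->
  (forall y, C y -> B y \/ exists2 x, A x & f x = y) ->
  count_set C = count_set A + count_set B.
Proof.
move=> finA finB inj_f fA BC surj.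
rewrite (@count_setU_disj _ (f @` A) B); first last.
- by move=> x; split=> [/surj[]|[[y /fA[? _] <-]|/BC]] //; [right|left].
- by move=> _ [x /fA[_ ?] <-].
- exact: finB.
- exact: finite_image.
by congr (_ + _); apply: count_set_bij finA inj_f _ _ => // x Ax; exists x.
Qed.

(** Multiplication of a generating function by q^D, on coefficients. *)
Definition shift (D : nat) (g : nat -> nat) (n : nat) : nat :=
  if D <= n then g (n - D) else 0.

Lemma count_set_shift (T : choiceType) (A : nat -> set T) D n :
  count_set [set x | D <= n /\ A (n - D) x] =
  shift D (fun m => count_set (A m)) n.
Proof.
rewrite /shift; case: leqP => [le_Dn|lt_nD].
  by congr count_set; apply/seteqP; split=> x // [].
by rewrite count_set_eq0 // => x [].
Qed.

Definition top_alpha (c : chain) := if c is (_, (a, _)) :: _ then a else [::].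
Definition top_beta (c : chain) := if c is (_, (_, b)) :: _ then b else [::].

Definition add_alpha (c : chain) : chain :=
  if c is (d, (a, b)) :: c' then (d, (d :: a, b)) :: c' else [::].
Definition add_beta (c : chain) : chain :=
  if c is (d, (a, b)) :: c' then (d, (a, d :: b)) :: c' else [::].

(** Parts decrease and are at most D, so for D > 0 a head different from D means that D does not
    occur as a part. *)
Definition chains1 i k D j n : set chain :=
  [set c | chains i k D j n c /\ head 0 (top_alpha c) != D].
Definition chains2 i k D j n : set chain :=
  [set c | chains1 i k D j n c /\ head 0 (top_beta c) != D].

(** Removing a part D from the top alpha lowers the rank of the top pair by one. This is the factor
    1 / (1 - z^eps q^D), with eps = 1 if i marks the top pair and eps = 0 otherwise. *)
Lemma nb_chains_step1 i k D j n : 0 < D ->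
  nb_chains i k D j n = shift D (nb_chains i k D (j - (i == k.+1)%:R)%R) n
                + count_set (chains1 i k D j n).
Proof.
move=> D_gt0; rewrite /nb_chains -count_set_shift.
apply: (@count_set_step _ add_alpha).
- by apply: sub_chains_finite => c []; eauto.
- by apply: sub_chains_finite => c []; eauto.
- move=> [|[d [a b]] c] [|[d' [a' b']] c'] //=.
  by move=> _ _ [-> _ -> -> ->].
- move=> [|[d [a b]] c] [le_Dn [//= v [sz_c] td rk wt]].
  subst d; split; last by move=> [_] /=; rewrite eqxx.
  case/and4P: v => pa pb l_gt0 vc; split=> //=.
  + rewrite parts_in_cons pa pb l_gt0 vc !andbT.
    by case: (c) vc => [|[? ?] ?] //= /andP[].
  + by rewrite sz_c.
  + by move: rk; rewrite sz_c; case: eqP => _ rk; lia.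
  + by lia.
- by move=> c [].
- move=> [|[d [[|x a] b]] c] [//= v [sz_c] td rk wt].
    by left; split; [split=> //=; rewrite sz_c|rewrite /= eq_sym -lt0n].
  have [xD|xD] := eqVneq x D; last first.
    by left; split; [split=> //=; rewrite sz_c|].
  right; exists ((d, (a, b)) :: c); last by rewrite /= xD td.
  subst x; subst d; move: v; rewrite parts_in_cons.
  case/and4P=> /andP[_ pa] pb l0 vc.
  split; first by lia.
  split=> //=.
  + by rewrite pa pb l0 vc.
  + by rewrite sz_c.
  + by move: rk; rewrite sz_c; case: eqP => _ /=; lia.
  + by lia.
Qed.

(** Removing a part D from the top beta raises the rank instead: the factor 1 / (1 - z^-eps q^D). *)
Lemma nb_chains_step2 i k D j n : 0 < D ->
  count_set (chains1 i k D j n) =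
  shift D (fun m => count_set (chains1 i k D (j + (i == k.+1)%:R)%R m)) n
  + count_set (chains2 i k D j n).
Proof.
move=> D_gt0; rewrite -count_set_shift.
apply: (@count_set_step _ add_beta).
- by apply: sub_chains_finite => c [_ []]; eauto.
- by apply: sub_chains_finite => c [[]]; eauto.
- move=> [|[d [a b]] c] [|[d' [a' b']] c'] //=.
  by move=> _ _ [-> -> _ -> ->].
- move=> [|[d [a b]] c] [le_Dn [[//= v [sz_c] td rk wt] neq_a]].
  subst d; split; last by move=> [_] /=; rewrite eqxx.
  case/and4P: v => pa pb l_gt0 vc; split=> //; split=> //=.
  + rewrite parts_in_cons pa pb l_gt0 vc !andbT.
    by case: (c) vc => [|[? ?] ?] //= /andP[].
  + by rewrite sz_c.
  + by move: rk; rewrite sz_c; case: eqP => _ rk; lia.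
  + by lia.
- by move=> c [].
- move=> [|[d [a [|x b]]] c] [[//= v [sz_c] td rk wt] neq_a].
    left; split; last by rewrite /= eq_sym -lt0n.
    by split=> //; split=> //=; rewrite sz_c.
  have [xD|xD] := eqVneq x D; last first.
    by left; split=> //; split=> //; split=> //=; rewrite sz_c.
  right; exists ((d, (a, b)) :: c); last by rewrite /= xD td.
  subst x; subst d; move: v; rewrite parts_in_cons.
  case/and4P=> pa /andP[_ pb] l0 vc.
  split; first by lia.
  split=> //; split=> //=.
  + by rewrite pa pb l0 vc.
  + by rewrite sz_c.
  + by move: rk; rewrite sz_c; case: eqP => _ /=; lia.
  + by lia.
Qed.

Lemma crank_gt i c : size c < i -> crank i c = 0%R.
Proof.
elim: c => [|[d [a b]] c IHc] //= lt_i.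
by rewrite gtn_eqF // IHc // ltnW.
Qed.

Definition push_empty (c : chain) : chain := (top c, ([::], [::])) :: c.
Definition lift_top (c : chain) : chain :=
  if c is (d, p) :: c' then (d.+1, p) :: c' else [::].

Lemma nb_chains_step3 i k D j n :
  count_set (chains2 i k D.+1 j n) =
  (if k is k'.+1 then shift D.+1 (nb_chains i k' D.+1 j) n else 0)
  + nb_chains i k D j n.
Proof.
pose A := [set c : chain | 0 < k /\
  (D.+1 <= n /\ chains i k.-1 D.+1 j (n - D.+1) c)].
pose B := lift_top @` chains i k D j n.
have -> : (if k is k'.+1 then shift D.+1 (nb_chains i k' D.+1 j) n else 0) =
          count_set A.
  rewrite /A {A B}; case: k => [|k] /=.
    by rewrite count_set_eq0 // => x [].
  rewrite -count_set_shift; congr count_set.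
  by apply/seteqP; split=> x // [].
have -> : nb_chains i k D j n = count_set B.
  symmetry; apply: (@count_set_bij _ _ lift_top).
  - exact: finite_chains.
  - move=> [|[d p] c] [|[d' p'] c'] //= [_ _ td _ _] [_ _ td' _ _] [dd -> ->].
    by rewrite dd.
  - by move=> c cc; exists c.
  - by move=> _ [c cc <-]; exists c.
rewrite -addnC addnC; apply: (@count_set_step _ push_empty).
- by apply: (@sub_chains_finite _ i k.-1 D.+1 j (n - D.+1)) => c [_ []].
- by apply: finite_image; apply: finite_chains.
- by move=> x y _ _ [].
- move=> c [k_gt0 [le_Dn [v sz_c td rk wt]]]; rewrite prednK // in sz_c.
  split; last first.
    (* The two cases are disjoint: below a lifted top the next entry is at most D, below a pushed
       pair it is D + 1. *)
    move=> [[|[d [a b]] c'] // [vc' _ td' _ _]] /= [dD _ _ cc'].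
    move: vc' => /= /and4P[_ _ _]; rewrite cc'.
    rewrite /= in td'; case: (c) sz_c td => [|[d2 p2] c2] /=; first by lia.
    by move=> _ -> /andP[]; lia.
  split; last by [].
  split; last by [].
  split=> //=.
  + rewrite /parts_in /= v; case: (c) sz_c td k_gt0 => [|[d2 p2] c2] /=; lia.
  + by rewrite sz_c.
  (* If i marks the new pair, its rank is 0, and j is 0 as well because i lies beyond the end of the
     shorter chain. *)
  + case: eqP => // ik.
    by rewrite -rk crank_gt // ik.
  + lia.
- move=> _ [[|[d [a b]] c] [//= v [sz_c] td rk wt] <-].
  case/and4P: v => pa pb l0 vc; subst d.
  move: pa pb; rewrite -(parts_inS _ _ a) -(parts_inS _ _ b).
  move=> /andP[pa na] /andP[pb nb].
  split=> //; split=> //; split=> //=.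
  + rewrite pa pb l0 /=; case/orP: vc => [->//|/andP[lc ->]].
    by rewrite andbT; apply/orP; right; lia.
  + by rewrite sz_c.
- move=> [|[d [a b]] c] [[[//= v [sz_c] td rk wt] na] nb]; subst d.
  case/and4P: v => pa pb l0 vc.
  have {}pa : parts_in (low c) D a by rewrite -parts_inS pa.
  have {}pb : parts_in (low c) D b by rewrite -parts_inS pb.
  have [/andP[c0 cD]|Hc] := boolP ((c != [::]) && (top c == D.+1)).
    have lowD : low c = D.+1 by case: (c) c0 cD => [|[? ?] ?] //= _ /eqP.
    have nil s : parts_in (low c) D s -> s = [::].
      by rewrite lowD; case: s => // x s /andP[_ /= /andP[]]; lia.
    rewrite (nil _ pa) (nil _ pb) in wt rk *.
    have k_gt0 : 0 < k by rewrite -sz_c; case: (c) c0.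
    right; exists c; last by rewrite /push_empty (eqP cD).
    rewrite /= (eqP cD) in wt.
    split=> //; split; first by lia.
    split=> //.
    + by move: vc; rewrite (negbTE c0) => /andP[].
    + by rewrite sz_c prednK.
    + exact/eqP.
    + rewrite -rk; case: eqP => // ik.
      by rewrite crank_gt // ik.
    + lia.
  left; exists ((D, (a, b)) :: c) => //.
  split=> //=; last by rewrite sz_c.
  rewrite pa pb l0 /=; case/orP: vc => [->//|/andP[lc ->]].
  rewrite andbT; move: Hc lc; case: (c) => [|[d2 p2] c2] //=; lia.
Qed.

Lemma eq_shift D g h n : (D <= n -> g (n - D) = h (n - D)) ->
  shift D g n = shift D h n.
Proof. by rewrite /shift; case: leqP => // le_Dn ->. Qed.

Lemma shiftD D g h n :
  shift D (fun m => g m + h m) n = shift D g n + shift D h n.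
Proof. by rewrite /shift; case: leqP. Qed.

(* With eps = 1 if i = k.+1 and eps = 0 otherwise, this is the identity
   (1 - z^eps q^D) (1 - z^-eps q^D) E_k(D) = E_k(D-1) + q^D E_(k-1)(D)
   between the generating functions of the numbers [nb_chains i k D j n]. *)
Lemma nb_chains_rec i k D j n (eps : int := ((i == k.+1)%:R)%R) :
  nb_chains i k D.+1 j n + shift D.+1 (shift D.+1 (nb_chains i k D.+1 j)) n =
  shift D.+1 (nb_chains i k D.+1 (j - eps)%R) n
  + shift D.+1 (nb_chains i k D.+1 (j + eps)%R) n
  + ((if k is k'.+1 then shift D.+1 (nb_chains i k' D.+1 j) n else 0)
     + nb_chains i k D j n).
Proof.
rewrite -nb_chains_step3 (@nb_chains_step1 i k D.+1 j) // -/eps.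
rewrite nb_chains_step2 // -/eps.
(* The first step at rank j + eps, shifted once more, eliminates [chains1]. *)
have -> : shift D.+1 (nb_chains i k D.+1 (j + eps)%R) n =
    shift D.+1 (shift D.+1 (nb_chains i k D.+1 j)) n +
    shift D.+1 (fun m => count_set (chains1 i k D.+1 (j + eps)%R m)) n.
  rewrite -shiftD; apply: eq_shift => _.
  by rewrite nb_chains_step1 // -/eps addrK.
have sumAC x y z t : x + (y + z) + t = x + (t + y) + z by lia.
exact: sumAC.
Qed.

(** No part lies between 1 and 0, and a second pair would need a positive entry below 0; only the
    single empty pair remains. *)
Lemma nb_chains_side0 i k j n :
  nb_chains i k 0 j n = [&& k == 0, j == 0%R & n == 0].
Proof.
have nil s : parts_in 1 0 s -> s = [::].
  by case: s => // x s /andP[_ /= /andP[]]; lia.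
case: andP => [[/eqP -> /andP[/eqP -> /eqP ->]]|H].
  rewrite /nb_chains /count_set.
  rewrite [X in fset_set X](_ : _ = [set [:: (0, ([::], [::]))]]).
    by rewrite fset_set1 cardfs1.
  apply/seteqP; split=> [[|[d [a b]] [|x c]] [] //= v _ td _ _|_ ->].
    by move: v; rewrite td => /and3P[/nil -> /nil ->].
  by split=> //=; case: eqP.
rewrite /nb_chains count_set_eq0 // => -[|[d [a b]] c] [//= v [sz_c] td rk wt].
subst d; case/and4P: v => pa pb l0 vc; apply: H.
case: c sz_c vc pa pb l0 rk wt => [|[d2 p2] c] /=; last first.
  by move=> _ /andP[]; lia.
move=> k0 _ /nil -> /nil -> _ /=; rewrite -k0 => rk wt; split=> //.
by rewrite -wt -rk; case: ifP.
Qed.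

(** * Second differences *)

(* In terms of generating functions, with the variable z in the bottom
   position: (z - 2 + z^-1) E_k.+1(D; z) = E_k(D; z) - E_k(D; 1). *)
Lemma nb_chains_diff2 k D (j : int) n :
  nb_chains 1 k.+1 D (j + 1)%R n + nb_chains 1 k.+1 D (j - 1)%R n
    + (j == 0%R) * nb_chains 0 k D 0%R n =
  nb_chains 1 k D j n + 2 * nb_chains 1 k.+1 D j n.
Proof.
elim: k D n j => [|k IHk]; (elim=> [|D IHD] n j;
  first by rewrite !nb_chains_side0; do !case: eqP; lia);
  elim/ltn_ind: n j => n IHn j.
(* In E_0 the pair marked by z is the top one. With Q = q^(D+1), the step rests on (1 - Q)^2 = (1 -
   zQ)(1 - Q/z) + Q(z - 2 + 1/z). *)
- have := nb_chains_rec 1 1 D (j + 1)%R n.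
  have := nb_chains_rec 1 1 D (j - 1)%R n.
  have := nb_chains_rec 1 1 D j n; have := nb_chains_rec 1 0 D j n.
  have := nb_chains_rec 0 0 D 0%R n.
  have := IHD n j; have := IHn (n - D.+1) ^~ j.
  have := IHn (n - D.+1 - D.+1) ^~ j.
  rewrite /= !subr0 ?addr0 /shift.
  move: (j + 1)%R (j - 1)%R => jp jm.
  case: (leqP D.+1 n) => le1; last first.
    by case: eqP => _; lia.
  case: (leqP D.+1 (n - D.+1)) => le2 H2 H1;
    (have {}H1 := H1 ltac:(lia)); (have {}H2 := H2 ltac:(lia)); move: H1 H2;
    by case: eqP => _; lia.
(* Here the marked pair is never on top, so every recurrence has the same factor (1 - Q)^2 and the
   claim is carried through linearly. *)
have := nb_chains_rec 1 k.+2 D (j + 1)%R n.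
have := nb_chains_rec 1 k.+2 D (j - 1)%R n.
have := nb_chains_rec 1 k.+2 D j n; have := nb_chains_rec 1 k.+1 D j n.
have := nb_chains_rec 0 k.+1 D 0%R n.
have := IHD n j; have := IHn (n - D.+1) ^~ j; have := IHk D.+1 (n - D.+1) j.
have := IHn (n - D.+1 - D.+1) ^~ j.
rewrite /= !subr0 ?addr0 /shift.
move: (j + 1)%R (j - 1)%R => jp jm.
case: (leqP D.+1 n) => le1; last first.
  by case: eqP => _; lia.
case: (leqP D.+1 (n - D.+1)) => le2 H2 H3 H1;
  (have {}H1 := H1 ltac:(lia)); (have {}H2 := H2 ltac:(lia)); move: H1 H2 H3;
  by case: eqP => _; lia.
Qed.

Lemma nb_chains_slot_gt i k D (j : int) n : k.+1 < i ->
  nb_chains i k D j n = (j == 0%R) * nb_chains 0 k D 0%R n.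
Proof.
move=> lt_ki; case: eqVneq => [->|j0].
  rewrite mul1n /nb_chains; congr count_set; apply/seteqP.
  split=> c [vc sc td _ wc]; split=> //.
    by elim: (c) => [|[d [a b]] c' IH].
  by rewrite crank_gt // sc.
rewrite mul0n /nb_chains count_set_eq0 // => c [_ sc _ rk _].
by case/eqP: j0; rewrite -rk crank_gt // sc.
Qed.

(** With z at the bottom, (1 - Q)^2 E_k(D+1; z) = E_k(D; z) + Q E_(k-1)(D+1; z) for Q = q^(D+1).
    Subtracting Q times [nb_chains_diff2] turns the left factor into (1 - zQ)(1 - Q/z) and the last
    term into Q E_(k-1)(D+1; 1): this is the recurrence with z at the top. *)
Lemma nb_chains_slot_top k D (j : int) n :
  nb_chains k.+1 k D j n = nb_chains 1 k D j n.
Proof.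
case: k => // k; elim: D n j => [|D IHD] n j; first by rewrite !nb_chains_side0.
elim/ltn_ind: n j => n IHn j.
have := nb_chains_rec k.+2 k.+1 D j n; have := nb_chains_rec 1 k.+1 D j n.
have := nb_chains_diff2 k D.+1 j (n - D.+1).
have := IHD n j; have := IHn (n - D.+1) ^~ j.
have := IHn (n - D.+1) ^~ (j + 1)%R; have := IHn (n - D.+1) ^~ (j - 1)%R.
have := IHn (n - D.+1 - D.+1) ^~ j.
have := @nb_chains_slot_gt k.+2 k D.+1 j (n - D.+1) (leqnn _).
rewrite eqxx /= !subr0 ?addr0 /shift.
move: (j + 1)%R (j - 1)%R => jp jm.
case: (leqP D.+1 n) => le1; last by lia.
case: (leqP D.+1 (n - D.+1)) => le2 -> H1 H2 H3 H4;
  (have {}H1 := H1 ltac:(lia)); (have {}H2 := H2 ltac:(lia));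
  (have {}H3 := H3 ltac:(lia)); (have {}H4 := H4 ltac:(lia)); move: H1 H2 H3 H4;
  by case: eqP => _; lia.
Qed.

(** Below the top, the recurrence does not see which pair is marked, so induction on k and D
    suffices. *)
Lemma nb_chains_slot i k D (j : int) n :
  0 < i <= k.+1 -> nb_chains i k D j n = nb_chains 1 k D j n.
Proof.
elim: k D n j => [|k IHk] D n j hi.
  by have -> : i = 1 by lia.
have [-> |i_neq] := eqVneq i k.+2; first exact: nb_chains_slot_top.
have {}hi : 0 < i <= k.+1 by lia.
elim: D n j => [|D IHD] n j; first by rewrite !nb_chains_side0.
elim/ltn_ind: n j => n IHn j.
have := nb_chains_rec i k.+1 D j n; have := nb_chains_rec 1 k.+1 D j n.
have := IHD n j; have := IHn (n - D.+1) ^~ j.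
have := IHn (n - D.+1 - D.+1) ^~ j; have := IHk D.+1 (n - D.+1) j hi.
rewrite (negbTE i_neq) /= !subr0 ?addr0 /shift.
case: (leqP D.+1 n) => le1; last by lia.
case: (leqP D.+1 (n - D.+1)) => le2 -> H1 H2;
  (have {}H1 := H1 ltac:(lia)); (have {}H2 := H2 ltac:(lia)); move: H1 H2;
  by lia.
Qed.

(** * Inverting the second difference *)

Lemma crank_le i c : valid c -> (crank i c <= (weight c)%:Z)%R.
Proof.
elim: c => [|[d [a b]] c IHc] //= /and4P[pa pb l0 vc].
have := size_parts l0 pa; case: eqP => _; first by lia.
by case/orP: vc => [/eqP -> /=|/andP[_ /IHc]]; lia.
Qed.

Lemma nb_chains_rank_gt i k D (m n : nat) :
  n < m -> nb_chains i k D m%:Z%R n = 0.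
Proof.
move=> lt_nm; rewrite /nb_chains count_set_eq0 // => c [vc _ _ rk wt].
by have := crank_le i vc; lia.
Qed.

(* As a function of j, this is the k-fold second antiderivative, vanishing for
   large j, of the Kronecker delta at m; see [diff2_kernel_rec]. *)
Definition diff2_kernel (k m j : nat) : nat :=
  if k is k'.+1 then 'C(m - j + k', (2 * k').+1) else m == j.

Lemma diff2_kernel_small k m j : m < j -> diff2_kernel k m j = 0.
Proof.
case: k => [|k] lt_mj; first by rewrite /= ltn_eqF.
by rewrite /= bin_small //; lia.
Qed.

(** For k >= 1 this is Pascal's rule applied twice: C(x+2, r+2) - 2 C(x+1, r+2) + C(x, r+2) = C(x,
    r) with x = m - j - 2 + k and r = 2k - 1. For k = 0 it is the second difference of max(m - j,
    0). *)
Lemma diff2_kernel_rec k m j :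
  diff2_kernel k.+1 m j.+2 + diff2_kernel k.+1 m j =
  diff2_kernel k m j.+1 + 2 * diff2_kernel k.+1 m j.+1.
Proof.
case: k => [|k] /=; first by rewrite !addn0 !bin1; case: eqP; lia.
(* Where subtraction may truncate, all four binomials vanish. *)
have [le_mj|lt_jm] := leqP m j.+1; first by rewrite !bin_small //; lia.
have -> : m - j + k.+1 = (m - j.+2 + k.+1).+2 by lia.
have -> : m - j.+1 + k.+1 = (m - j.+2 + k.+1).+1 by lia.
have -> : m - j.+1 + k = m - j.+2 + k.+1 by lia.
have -> : 2 * k.+1 = (2 * k).+2 by lia.
by rewrite !binS; lia.
Qed.

(** Both sides vanish for j > n and, by induction on k, have the same second difference at every
    positive rank; descending induction on j then makes them equal. *)
Lemma nb_chains_closed k D (j n : nat) :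
  nb_chains 1 k D j%:Z%R n =
  \sum_(m < n.+1) diff2_kernel k m j * nb_chains 1 0 D (m : nat)%:Z%R n.
Proof.
have far k' j' : n < j' -> nb_chains 1 k' D j'%:Z%R n =
    \sum_(m < n.+1) diff2_kernel k' m j' * nb_chains 1 0 D (m : nat)%:Z%R n.
  move=> lt_nj; rewrite nb_chains_rank_gt // big1 // => m _.
  by rewrite diff2_kernel_small //; have := ltn_ord m; lia.
elim: k j => [|k IHk] j.
  have [le_jn|/far //] := leqP j n.
  rewrite (bigD1 (inord j)) //= inordK // eqxx mul1n big1 ?addn0 // => m.
  by rewrite -val_eqE /= inordK // => /negbTE ->.
have [r] := ubnP (n.+1 - j); elim: r j => // r IHr j le_r.
have [le_jn|/far //] := leqP j n.
have IH1 := IHr j.+1 ltac:(lia); have IH2 := IHr j.+2 ltac:(lia).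
(* The difference is centred at j + 1, so the term supported at rank 0 drops out, and the values at
   j + 1 and j + 2 determine the one at j. *)
have := nb_chains_diff2 k D j.+1%:Z%R n.
have -> : (j.+1%:Z + 1)%R = j.+2%:Z%R by lia.
have -> : (j.+1%:Z - 1)%R = j%:Z%R by lia.
rewrite mul0n addn0 IH1 IH2 IHk => /esym.
rewrite big_distrr /= -big_split /=.
under eq_bigr => m _ do rewrite mulnA -mulnDl -diff2_kernel_rec mulnDl.
by rewrite big_split /= => /addnI.
Qed.

(** * Symbols and chains *)

Definition all_chains i k (j : int) n : set chain :=
  [set c | [/\ valid c, size c = k.+1, 0 < top c, crank i c = j
             & weight c + top c ^ 2 = n]].

Lemma finite_all_chains i k j n : finite_set (all_chains i k j n).
Proof.
apply: sub_finite_set (finite_chains_le k n) => c [vc sc _ _ <-].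
by split=> //; rewrite addnC leq_add2l expnS expn1; case: top => // d; lia.
Qed.

Lemma count_all_chains i k j n :
  count_set (all_chains i k j n) =
  \sum_(D < n.+1 | 0 < D) shift (D ^ 2) (nb_chains i k D j) n.
Proof.
rewrite (@count_set_fibers _ _ top n.+1); first last.
- by move=> c [_ _ _ _ <-]; rewrite ltnS expnS expn1; case: top => // d; lia.
- exact: finite_all_chains.
rewrite [RHS]big_mkcond; apply: eq_bigr => D _; case: posnP => [D0|D_gt0].
  by rewrite count_set_eq0 // => c [[_ _ + _ _] td]; rewrite td D0.
move: (nat_of_ord D) D_gt0 => {}D D_gt0.
rewrite -count_set_shift; congr count_set; apply/seteqP.
split=> c /= [].
  move=> [vc sc tc rc wc] td; rewrite td in wc.
  by rewrite -wc leq_addl; split=> //; split=> //; rewrite addnK.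
move=> le_n [vc sc td rc wc]; split=> //.
by split=> //; rewrite td // wc subnK.
Qed.

Section ChainOfSymbol.
Variables (k : nat) (tau : symbol k.+1).

Definition bound_part (j : nat) : nat :=
  if j == k.+1 then side tau else head 0 (alpha tau j).
Definition free_parts (j : nat) : seq nat :=
  if j == k.+1 then alpha tau j else behead (alpha tau j).
Definition low_part (j : nat) : nat :=
  if j is j'.+2 then bound_part j'.+1 else 1.

Fixpoint chain_upto (j : nat) : chain :=
  if j is j'.+1 then
    (bound_part j, (free_parts j, beta tau j)) :: chain_upto j'
  else [::].

(** Stated for the whole of alpha^j, to match the conditions on symbols; [parts_in_free] passes to
    the shortened partition stored in the chain. *)
Definition slot_ok (j : nat) : Prop :=
  [/\ parts_in (low_part j) (bound_part j) (alpha tau j),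
      parts_in (low_part j) (bound_part j) (beta tau j),
      0 < low_part j & low_part j <= bound_part j].

Lemma size_chain_upto j : size (chain_upto j) = j.
Proof. by elim: j => //= j ->. Qed.

Lemma crank_chain_upto i j : 0 < i <= j ->
  crank i (chain_upto j) =
  ((size (free_parts i))%:Z - (size (beta tau i))%:Z)%R.
Proof.
elim: j => [|j IHj] hi; first by lia.
by rewrite /= size_chain_upto; case: eqP => [->|] // ?; apply: IHj; lia.
Qed.

Lemma weight_chain_upto j :
  top (chain_upto j) + weight (chain_upto j) =
  \sum_(1 <= j' < j.+1)
     (bound_part j' + sumn (free_parts j') + sumn (beta tau j')).
Proof.
elim: j => [|j IHj]; first by rewrite big_geq.
by rewrite big_nat_recr //= -IHj; lia.
Qed.

Hypothesis alpha_neq0 : forall j, 1 <= j < k.+1 -> alpha tau j <> [::].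

Lemma parts_in_free j : 0 < j <= k.+1 -> low_part j <= bound_part j ->
  parts_in (low_part j) (bound_part j) (free_parts j) =
  parts_in (low_part j) (bound_part j) (alpha tau j).
Proof.
rewrite /free_parts /bound_part; case: eqVneq => // j_neq hj le_j.
have /alpha_neq0 : 1 <= j < k.+1 by lia.
case: (alpha tau j) le_j => // x s le_x _ /=.
by rewrite parts_in_cons le_x.
Qed.

(** A valid one-pair chain may have top 0; positivity of the top entry supplies the inequality
    [low_part 1 <= bound_part 1]. Higher up, [valid] itself compares neighbouring entries. *)
Lemma valid_chain_upto j : j <= k -> 0 < side tau ->
  valid (chain_upto j.+1) && (0 < bound_part j.+1) <->
  (forall j', 0 < j' <= j.+1 -> slot_ok j').
Proof.
move=> le_jk side_gt0; elim: j le_jk => [_|j IHj le_jk].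
  split.
    move=> /andP[/and4P[pa pb l0 _] b0] j' hj; have -> : j' = 1 by lia.
    by split=> //; rewrite -parts_in_free.
  move=> /(_ 1 isT)[pa pb l0 lb].
  rewrite -(parts_in_free _ lb) // in pa.
  by rewrite lb andbT; apply/and4P; split.
have [IH1 IH2] := IHj (ltnW le_jk).
split.
  move=> /andP[/and4P[pa pb l0 vc] b0] j' hj.
  case/orP: vc => [/eqP //|/andP[lb vc]].
  have [->|j_neq] := eqVneq j' j.+2; last first.
    by apply: IH1; [apply/andP; split; [exact: vc|exact: l0]|lia].
  by split=> //; rewrite -parts_in_free.
move=> ok; have [pa pb l0 lb] := ok j.+2 ltac:(lia).
have /andP[vc b0] : valid (chain_upto j.+1) && (0 < bound_part j.+1).
  by apply: IH2 => j' hj; apply: ok; lia.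
apply/andP; split; last by apply: leq_trans lb.
rewrite -(parts_in_free _ lb) // in pa.
apply/and4P; split; [exact: pa|exact: pb|exact: l0|].
by apply/orP; right; apply/andP; split.
Qed.

End ChainOfSymbol.

(** Marked Durfee symbols are defined through extreme parts, chains through all parts. The empty
    partition is listed apart because its [smallest] is 0. *)
Lemma parts_inE l d s : 0 < l ->
  parts_in l d s =
  [&& is_partition s, (s == [::]) || (l <= Defs.smallest s) & largest s <= d].
Proof.
move=> l_gt0; rewrite /parts_in /is_partition /largest /Defs.smallest.
case: s => // x s /=; have tr : transitive geq by move=> ? ? ? /=; lia.
rewrite path_sortedE //.
have [xs|] := boolP (all (geq x) s); last by [].
have [ss|] := boolP (sorted geq s); last by [].
rewrite !andTb.
have le_last y : y \in x :: s -> last x s <= y <= x.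
  move=> ys; apply/andP; split; last first.
    by move: ys; rewrite inE => /predU1P[->|/(allP xs)].
  have : sorted geq (x :: s) by rewrite /= path_sortedE // xs.
  elim: (s) (x) (y) ys {xs ss} => [|z t IH] w v /=.
    by rewrite inE => /eqP ->.
  rewrite inE => /predU1P[->|zt] /andP[wz zs]; last exact: IH.
  by apply: leq_trans wz; apply: IH zs; rewrite mem_head.
have last_in : last x s \in x :: s := mem_last x s.
have le_x := le_last x (mem_head _ _).
apply/idP/idP => [/andP[/andP[lx xd] /allP lsd]|/and3P[_ lx xd]].
  have ll : l <= last x s.
    by move: last_in; rewrite inE => /predU1P[->|/lsd /andP[]].
  rewrite ll xd !andbT; apply/andP; split; first by lia.
  by apply/allP => y /lsd /andP[ly _]; lia.
apply/andP; split; first by lia.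
apply/allP => y ys.
by have := le_last y (mem_behead (ys : y \in behead (x :: s))); lia.
Qed.

Lemma smallest_gt0 s : is_partition s -> (s == [::]) || (1 <= Defs.smallest s).
Proof.
case: s => // x s /andP[_ /allP s_gt0].
exact: s_gt0 (mem_last x s).
Qed.

Lemma smallest_le_largest s : is_partition s -> Defs.smallest s <= largest s.
Proof.
move=> s_part; have : parts_in 1 (largest s) s.
  by rewrite parts_inE // s_part smallest_gt0 ?leqnn.
case: s {s_part} => // x s /andP[_ /allP /(_ _ (mem_last x s))].
by case/andP.
Qed.

Lemma largest_gt0 s : is_partition s -> s <> [::] -> 0 < largest s.
Proof. by case: s => // x s /andP[_ /andP[]]. Qed.

Lemma le_min_part k (tau : symbol k) j x :
  (x <= min_part tau j) =
  [&& x <= side tau,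
      (alpha tau j == [::]) || (x <= Defs.smallest (alpha tau j)) &
      (beta tau j == [::]) || (x <= Defs.smallest (beta tau j))].
Proof.
rewrite /min_part !big_cons big_nil.
by case: eqP; case: eqP => _ _; rewrite /= ?leq_min ?andbT //;
  [rewrite andbC|rewrite andbC|rewrite andbA andbC].
Qed.

Section MarkedDurfee.
Variables (k n : nat) (tau : symbol k.+1).

(** The removed first part of alpha^j reappears as the top of the chain below pair j + 1, which
    [weight] counts; the top entry D is not counted. *)
Lemma weight_symbol :
  weight (chain_upto tau k.+1) =
  \sum_(1 <= j < k.+2) (sumn (alpha tau j) + sumn (beta tau j)).
Proof.
rewrite big_nat_recr //= weight_chain_upto /free_parts eqxx addnC.
congr (_ + _).
apply: eq_big_nat => j hj; have /negbTE j_neq : j != k.+1 by lia.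
by rewrite /bound_part j_neq; case: (alpha tau j).
Qed.

Lemma low_partS j : 0 < j -> low_part tau j.+1 = bound_part tau j.
Proof. by case: j. Qed.

Lemma bound_part_low j : j < k.+1 -> bound_part tau j = largest (alpha tau j).
Proof. by move=> lt_jk; rewrite /bound_part ltn_eqF. Qed.

Lemma bound_part_top : bound_part tau k.+1 = side tau.
Proof. by rewrite /bound_part eqxx. Qed.

(** Slots compare neighbours only, whereas [min_part] also involves D; the bounds increase from slot
    to slot up to D. *)
Lemma bound_le_side j : (forall j, 0 < j <= k.+1 -> slot_ok tau j) ->
  0 < j <= k.+1 -> bound_part tau j <= side tau.
Proof.
move=> ok; have [r] := ubnP (k.+1 - j); elim: r j => // r IHr j le_r hj.
have [->|j_neq] := eqVneq j k.+1; first by rewrite bound_part_top.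
apply: leq_trans (IHr j.+1 _ _); [|lia|lia].
have [_ _ _] := ok j.+1 ltac:(lia); by rewrite low_partS //; lia.
Qed.

Lemma marked_durfee_slots : is_marked_durfee n tau ->
  forall j, 0 < j <= k.+1 -> slot_ok tau j.
Proof.
case=> side_gt0 part nonempty chain [ba bb] _ j hj.
have /andP[pa pb] := part j hj.
have l_gt0 : 0 < low_part tau j.
  case: j hj {pa pb} => [|[|j]] hj //.
  rewrite low_partS // bound_part_low; last by lia.
  apply: largest_gt0; last by apply: nonempty; lia.
  by have /andP[] := part j.+1 ltac:(lia).
have : [&& low_part tau j <= side tau,
      (alpha tau j == [::]) || (low_part tau j <= Defs.smallest (alpha tau j)) &
      (beta tau j == [::]) || (low_part tau j <= Defs.smallest (beta tau j))].
  have [j1|j_neq] := eqVneq j 1.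
    by move: pa pb; rewrite j1 => /smallest_gt0 ? /smallest_gt0 ?; apply/and3P.
  rewrite -le_min_part; have /andP[_] := chain j ltac:(lia).
  case: j hj j_neq {pa pb l_gt0} => [|[|j]] hj j_neq // le_min.
  by rewrite low_partS // bound_part_low; [exact: le_min|lia].
case/and3P=> lD la lb.
have bnd_a : largest (alpha tau j) <= bound_part tau j.
  have [->|j_neq] := eqVneq j k.+1; first by rewrite bound_part_top.
  by rewrite bound_part_low //; lia.
have bnd_b : largest (beta tau j) <= bound_part tau j.
  have [->|j_neq] := eqVneq j k.+1; first by rewrite bound_part_top.
  rewrite bound_part_low; last by lia.
  by have /andP[] := chain j.+1 ltac:(lia).
split=> //; rewrite ?parts_inE ?pa ?pb ?la ?lb //.
(* Below the top slot alpha^j is nonempty, and the lower bound passes through its smallest part to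
   its largest. *)
have [jk|j_neq] := eqVneq j k.+1; first by rewrite {2}jk bound_part_top.
have /nonempty/eqP/negbTE a_neq0 : 1 <= j < k.+1 by lia.
rewrite a_neq0 /= in la; apply: leq_trans bnd_a; apply: leq_trans la _.
exact: smallest_le_largest.
Qed.

Lemma slots_marked_durfee : 0 < side tau ->
  (forall j, 1 <= j < k.+1 -> alpha tau j <> [::]) ->
  (forall j, 0 < j <= k.+1 -> slot_ok tau j) ->
  weight (chain_upto tau k.+1) + side tau ^ 2 = n -> is_marked_durfee n tau.
Proof.
move=> side_gt0 nonempty ok wt; split=> //.
- move=> j hj; have [pa pb l0 _] := ok j hj.
  by rewrite (parts_inW l0 pa) (parts_inW l0 pb).
- move=> [//|[//|j]] hj; have [pa pb l0 lb] := ok j.+2 hj.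
  have [pa' pb' l0' _] := ok j.+1 ltac:(lia).
  have := bound_le_side ok (_ : 0 < j.+1 <= k.+1).
  move: pa pb l0 pa' pb'; rewrite low_partS // bound_part_low; last by lia.
  move=> pa pb l0; rewrite !(parts_inE _ _ l0').
  move=> /and3P[_ _ _] /and3P[_ _ lb'].
  move: pa pb; rewrite !(parts_inE _ _ l0).
  move=> /and3P[_ sa _] /and3P[_ sb _] le_side.
  by rewrite lb' le_min_part sa sb le_side //; lia.
- have [pa pb l0 _] := ok k.+1 ltac:(lia).
  move: pa pb; rewrite !(parts_inE _ _ l0) bound_part_top.
  by move=> /and3P[_ _ ?] /and3P[_ _ ?].
- by rewrite -weight_symbol.
Qed.

End MarkedDurfee.

(** The summand -1 in the rank of a lower pair accounts for the first part of alpha^j, which the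
    chain stores separately. *)
Lemma rho_crank k (tau : symbol k.+1) i : 0 < i <= k.+1 ->
  (forall j, 1 <= j < k.+1 -> alpha tau j <> [::]) ->
  rho tau i = crank i (chain_upto tau k.+1).
Proof.
move=> hi nonempty; rewrite crank_chain_upto // /rho /free_parts.
case: ltnP => [lt_ik|ge_ik]; last first.
  by have -> : i = k.+1; [lia|rewrite eqxx].
rewrite ltn_eqF //; have : alpha tau i <> [::] by apply: nonempty; lia.
by case: alpha => // x s _ /=; lia.
Qed.

Lemma chain_upto_inj k (tau tau' : symbol k.+1) :
  (forall j, 1 <= j < k.+1 -> alpha tau j <> [::]) ->
  (forall j, 1 <= j < k.+1 -> alpha tau' j <> [::]) ->
  chain_upto tau k.+1 = chain_upto tau' k.+1 -> tau = tau'.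
Proof.
move=> ne ne' eq_c.
have eq_slot j0 j : chain_upto tau j0 = chain_upto tau' j0 -> 0 < j <= j0 ->
    [/\ bound_part tau j = bound_part tau' j,
        free_parts tau j = free_parts tau' j & beta tau j = beta tau' j].
  elim: j0 => [|j0 IHj] eqj hj; first by lia.
  case: eqj => eq1 eq2 eq3 /IHj {}IHj.
  by have [->|j_neq] := eqVneq j j0.+1; [split|apply: IHj; lia].
have eq_ab j : 0 < j <= k.+1 ->
    (alpha tau j, beta tau j) = (alpha tau' j, beta tau' j).
  move=> hj; have [eq1 eq2 ->] := eq_slot _ j eq_c hj.
  move: eq1 eq2; rewrite /bound_part /free_parts.
  case: eqP => [_ _ -> //|j_neq].
  have /ne : 1 <= j < k.+1 by lia.
  have /ne' : 1 <= j < k.+1 by lia.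
  by case: alpha => // x s; case: alpha => // x' s' _ _ /= -> ->.
have [] := eq_slot _ k.+1 eq_c; first by rewrite leqnn.
rewrite !bound_part_top => eq_side _ _.
case: tau tau' {ne ne' eq_c eq_slot} eq_ab eq_side => [t D] [t' D'] eq_ab.
rewrite /side /= => ->; congr pair; apply/val_inj/(@eq_from_nth _ ([::], [::])).
  by rewrite !size_tuple.
move=> j; rewrite size_tuple => lt_j; have := eq_ab j.+1 lt_j.
by rewrite /alpha /beta /= -!surjective_pairing.
Qed.

(** Chains start at the top and tuples at the bottom, whence the index k - i. The first part is put
    back everywhere except in the top pair, whose entry is D. *)
Definition symbol_of_chain k (c : chain) : symbol k.+1 :=
  ([tuple (let t := nth (0, ([::], [::])) c (k - i) in
           (if i == k :> nat then t.2.1 else t.1 :: t.2.1, t.2.2)) | i < k.+1],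
   top c).

Lemma chain_of_symbolK k c : size c = k.+1 ->
  chain_upto (symbol_of_chain k c) k.+1 = c.
Proof.
move=> sz_c.
suff dropE j : j <= k.+1 ->
    chain_upto (symbol_of_chain k c) j = drop (k.+1 - j) c.
  by rewrite dropE // subnn drop0.
elim: j => [|j IHj] lt_jk; first by rewrite subn0 drop_oversize ?sz_c.
rewrite (drop_nth (0, ([::], [::]))); last by rewrite sz_c; lia.
rewrite subSS -subSn // -IHj ?(ltnW lt_jk) //=; congr cons.
set t := nth _ _ _.
have slot :
    (alpha (symbol_of_chain k c) j.+1, beta (symbol_of_chain k c) j.+1) =
    (if j == k then t.2.1 else t.1 :: t.2.1, t.2.2).
  rewrite /alpha /beta /= -surjective_pairing.
  by rewrite (nth_mktuple _ _ (Ordinal lt_jk)).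
case: slot => eq_a eq_b; rewrite /bound_part /free_parts eq_a eq_b eqSS.
rewrite [RHS]surjective_pairing [(t.2)]surjective_pairing.
case: eqP => [jk|//]; congr pair.
by rewrite /side /= /t jk subnn; case: (c).
Qed.

Lemma count_marked_durfee k i n : 0 < i <= k.+1 ->
  count_set [set tau : symbol k.+1 | is_marked_durfee n tau /\ rho tau i = 0%R]
  = count_set (all_chains i k 0%R n).
Proof.
move=> hi; symmetry.
apply: (@count_set_bij _ _ (fun tau : symbol k.+1 => chain_upto tau k.+1)).
- by apply: sub_finite_set (finite_marked_durfee k.+1 n) => tau [].
- move=> tau tau' [[_ _ ne _ _ _] _] [[_ _ ne' _ _ _] _].
  exact: chain_upto_inj.
- move=> tau [mark rk]; have slots := marked_durfee_slots mark.
  case: mark => side_gt0 _ ne _ _ wt.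
  have /andP[vc b0] := (valid_chain_upto ne (leqnn k) side_gt0).2 slots.
  split=> //; first by rewrite size_chain_upto.
    by rewrite -rho_crank.
  by rewrite weight_symbol /= bound_part_top.
- move=> c [vc sc tc rc wc]; exists (symbol_of_chain k c); last first.
    exact: chain_of_symbolK.
  have cK := chain_of_symbolK sc.
  have side_gt0 : 0 < side (symbol_of_chain k c) by [].
  have ne j : 1 <= j < k.+1 -> alpha (symbol_of_chain k c) j <> [::].
    case: j => // j /andP[_ lt_jk]; rewrite /alpha /=.
    rewrite (nth_mktuple _ _ (Ordinal (ltnW lt_jk))) /=.
    by rewrite ltn_eqF.
  split; last by rewrite rho_crank // cK.
  apply: slots_marked_durfee => //; last by rewrite cK.
  apply/(valid_chain_upto ne (leqnn k) side_gt0).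
  by rewrite cK vc bound_part_top.
Qed.

(** * Durfee squares *)

(** Conjugation: [count (ltn i) s] is the length of column i of the diagram of [s], with rows and
    columns counted from 0. *)
Lemma ltn_count_sorted s t i : sorted geq s ->
  (t < count (ltn i) s) = (i < nth 0 s t).
Proof.
elim: s t => [|x s IHs] t /=; first by rewrite nth_nil !ltn0.
rewrite path_sortedE; last by move=> ? ? ? /=; lia.
move=> /andP[/allP xs ss]; have [lt_ix|le_xi] := ltnP i x.
  by case: t => [|t] //=; rewrite add1n ltnS IHs.
have -> : count (ltn i) s = 0.
  by apply/eqP; rewrite -leqn0 leqNgt -has_count; apply/hasPn => y /xs /=; lia.
case: t => [|t] /=; first by lia.
have [lt_t|ge_t] := ltnP t (size s); last by rewrite nth_default.
by have /= := xs _ (mem_nth 0 lt_t); lia.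
Qed.

Lemma eq_ltnr m n : (forall i, (i < m) = (i < n)) -> m = n.
Proof.
move=> eq_mn; apply/eqP; rewrite eqn_leq leqNgt eq_mn ltnn /=.
by rewrite leqNgt -eq_mn ltnn.
Qed.

Lemma sum_ltn_min d x : \sum_(i < d) (i < x) = minn d x.
Proof.
by elim: d => [|d IHd]; rewrite ?big_ord0 ?min0n // big_ord_recr /= IHd; lia.
Qed.

Lemma sum_count_ltn d s :
  all (geq d) s -> \sum_(i < d) count (ltn i) s = sumn s.
Proof.
elim: s => [|x s IHs] /=; first by rewrite big1.
by move=> /andP[le_xd /IHs <-]; rewrite big_split /= sum_ltn_min; lia.
Qed.

(* The partition whose Durfee square has side d, with the columns of a to the
   right of the square and the rows of b below it. *)
Definition durfee_join (d : nat) (a b : seq nat) : seq nat :=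
  [seq d + count (ltn i) a | i <- iota 0 d] ++ b.

Section DurfeeJoin.
Variables (d : nat) (a b : seq nat).
Hypotheses (d_gt0 : 0 < d) (a_in : parts_in 1 d a) (b_in : parts_in 1 d b).

Lemma parts_in_le l s : parts_in l d s -> all (geq d) s.
Proof. by move=> /andP[_ /allP ld]; apply/allP => x /ld /andP[]. Qed.

Lemma durfee_join_partition : is_partition (durfee_join d a b).
Proof.
apply/andP; split; last first.
  rewrite all_cat; have /andP[_ ->] := parts_inW (ltn0Sn 0) b_in.
  by rewrite andbT; apply/allP => _ /mapP[i _ ->]; lia.
have tr : transitive geq by move=> ? ? ? /=; lia.
have /andP[b_s _] := b_in.
rewrite sorted_pairwise // pairwise_cat -!sorted_pairwise // b_s andbT.
apply/andP; split.
  apply/allrelP => _ y /mapP[i _ ->] /(allP (parts_in_le b_in)) /=; lia.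
apply: (homo_sorted (e := leq)); last exact: iota_sorted.
move=> i j le_ij /=; rewrite leq_add2l; apply: sub_count => x /=; lia.
Qed.

Lemma sumn_durfee_join : sumn (durfee_join d a b) = sumn a + sumn b + d ^ 2.
Proof.
rewrite sumn_cat sumnE big_map -[X in iota 0 X]subn0 -/(index_iota 0 d).
rewrite big_mkord.
rewrite big_split /= sum_nat_const card_ord.
rewrite sum_count_ltn ?(parts_in_le a_in) //.
by rewrite expnS expn1; lia.
Qed.

Lemma count_gt0_parts : count (ltn 0) a = size a.
Proof.
by apply/eqP; rewrite -all_count; have /andP[] := parts_inW (ltn0Sn 0) a_in.
Qed.

(** Every column of [a] meets the first row, so the largest part is d + [size a]; there are d +
    [size b] parts, and d cancels. *)
Lemma rank_durfee_join :
  rank (durfee_join d a b) = ((size a)%:Z - (size b)%:Z)%R.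
Proof.
rewrite /rank /largest /durfee_join size_cat size_map size_iota.
by case: d d_gt0 => //= d' _; rewrite count_gt0_parts; lia.
Qed.

Lemma nth_durfee_join i :
  i < d -> nth 0 (durfee_join d a b) i = d + count (ltn i) a.
Proof.
move=> lt_id; rewrite nth_cat size_map size_iota lt_id.
by rewrite (nth_map 0) ?size_iota // nth_iota.
Qed.

Lemma nth_durfee_join_le : nth 0 (durfee_join d a b) d <= d.
Proof.
rewrite nth_cat size_map size_iota ltnn subnn.
by case: b b_in => // x s /parts_in_le /= /andP[].
Qed.

End DurfeeJoin.

(** Rows before index d have length at least d, and row d at most d, which determines d. Then [b] is
    the tail, and [a] is recovered by conjugation. *)
Lemma durfee_join_inj d d' a a' b b' : 0 < d -> 0 < d' ->
  parts_in 1 d a -> parts_in 1 d b -> parts_in 1 d' a' -> parts_in 1 d' b' ->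
  durfee_join d a b = durfee_join d' a' b' -> [/\ d = d', a = a' & b = b'].
Proof.
have le_side d1 d2 a1 a2 b1 b2 : parts_in 1 d1 b1 ->
    durfee_join d1 a1 b1 = durfee_join d2 a2 b2 -> d2 <= d1.
  move=> pb1 eq12; rewrite leqNgt; apply/negP => lt12.
  have := nth_durfee_join_le a1 pb1.
  by rewrite eq12 nth_durfee_join //; lia.
move=> d_gt0 d'_gt0 pa pb pa' pb' eq_j.
have dd : d = d' by apply/eqP; rewrite eqn_leq !(le_side _ _ _ _ _ _ _ eq_j) //
  (le_side _ _ _ _ _ _ _ (esym eq_j)).
subst d'; have eq_count i : i < d -> count (ltn i) a = count (ltn i) a'.
  move=> lt_id; apply/(@addnI d).
  by rewrite -(nth_durfee_join _ b lt_id) -(nth_durfee_join _ b' lt_id) eq_j.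
split=> //; last first.
  move: eq_j => /(congr1 (drop d)).
  by rewrite /durfee_join !drop_size_cat ?size_map ?size_iota.
apply: (@eq_from_nth _ 0).
  by rewrite -(count_gt0_parts pa) -(count_gt0_parts pa') eq_count.
move=> t _; apply: eq_ltnr => i.
have /andP[sa _] := pa; have /andP[sa' _] := pa'.
(* For i >= d both inequalities fail, since the parts are at most d. *)
rewrite -!ltn_count_sorted //; have [/eq_count -> //|le_di] := ltnP i d.
rewrite !ltn_count_sorted //.
have le_nth s : parts_in 1 d s -> nth 0 s t <= d.
  have [lt_t|?] := ltnP t (size s); last by rewrite nth_default.
  by move=> /parts_in_le /allP; apply; apply: mem_nth.
by have := le_nth _ pa; have := le_nth _ pa'; lia.
Qed.

Lemma durfee_join_surj la : is_partition la -> 0 < sumn la ->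
  exists d a b, [/\ 0 < d, parts_in 1 d a, parts_in 1 d b
                 & durfee_join d a b = la].
Proof.
move=> la_part la_gt0; have /andP[la_s /allP la_pos] := la_part.
have ex_d : exists d, nth 0 la d <= d by exists (size la); rewrite nth_default.
(* The least such d is the side of the Durfee square. *)
case: (ex_minnP ex_d) => d le_d d_min.
have d_gt0 : 0 < d.
  rewrite lt0n; apply/eqP => d0; move: le_d; rewrite d0 leqn0 => /eqP.
  case: la la_pos la_gt0 {la_part la_s ex_d d_min} => //= x s /(_ x).
  by rewrite mem_head => /(_ isT); lia.
have gt_d i : i < d -> d <= nth 0 la i.
  move=> lt_id; have : ~~ (nth 0 la d.-1 <= d.-1) by apply/negP => /d_min; lia.
  rewrite -ltnNge -!ltn_count_sorted // => lt_c.
  have := ltn_count_sorted i d.-1 la_s; rewrite prednK // => <-.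
  lia.
have le_dsz : d <= size la by apply: d_min; rewrite nth_default.
have nth_take_d i : nth 0 (take d la) i = if i < d then nth 0 la i else 0.
  case: ltnP => [lt_id|?]; first exact: nth_take.
  by rewrite nth_default // size_takel.
have take_s : sorted geq (take d la) by apply: take_sorted.
(* The conjugate of what lies to the right of the square. *)
pose a := [seq count (ltn (d + t)) (take d la) | t <- iota 0 (head 0 la - d)].
have a_s : sorted geq a.
  apply: (homo_sorted (e := leq)); last exact: iota_sorted.
  by move=> i j le_ij /=; apply: sub_count => x /=; lia.
have nth_a i y : (i < nth 0 a y) = (i < d) && (d + y < nth 0 la i).
  have [lt_y|ge_y] := ltnP y (head 0 la - d).
    rewrite (nth_map 0) ?size_iota // nth_iota //.
    rewrite ltn_count_sorted // nth_take_d.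
    by rewrite add0n; case: (i < d).
  rewrite nth_default ?size_map ?size_iota // ltn0; symmetry; apply/negbTE.
  rewrite negb_and -leqNgt -leqNgt; apply/orP; right.
  apply: (@leq_trans (head 0 la)); last by lia.
  rewrite leqNgt -ltn_count_sorted //.
  have := ltn_count_sorted 0 (head 0 la) la_s; rewrite nth0 ltnn; lia.
exists d, a, (drop d la); split=> //.
- apply/andP; split=> //; apply/allP => _ /mapP[y + ->].
  rewrite mem_iota add0n => /andP[_ lt_y]; apply/andP; split.
    by rewrite ltn_count_sorted // nth_take_d d_gt0 nth0; lia.
  by apply: leq_trans (count_size _ _) _; rewrite size_takel.
- have b_part : is_partition (drop d la).
    apply/andP; split; first exact: drop_sorted.
    by apply/allP => x /mem_drop /la_pos.
  rewrite parts_inE // b_part smallest_gt0 //.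
  by rewrite /largest -nth0 nth_drop addn0.
- rewrite -[RHS](cat_take_drop d); congr (_ ++ _).
  apply: (@eq_from_nth _ 0); rewrite size_map size_iota ?size_takel //.
  move=> i lt_id; rewrite (nth_map 0) ?size_iota // nth_iota //.
  rewrite nth_take // add0n.
  rewrite -[RHS](subnKC (gt_d i lt_id)); congr (_ + _).
  by apply: eq_ltnr => y; rewrite ltn_count_sorted // nth_a lt_id; lia.
Qed.

(** A one-pair chain is the Durfee dissection of a partition; n > 0 guarantees a square of positive
    side. *)
Lemma N_all_chains (m : int) n :
  0 < n -> N m n = count_set (all_chains 1 0 m n).
Proof.
move=> n_gt0; apply: (@count_set_bij _ _
  (fun c : chain => durfee_join (top c) (top_alpha c) (top_beta c))).
- exact: finite_all_chains.
- move=> [|[d [a b]] [|? ?]] [|[d' [a' b']] [|? ?]]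
    [//= v _ + _ _] [//= v' _ + _ _].
  move: v v' => /and3P[pa pb _] /and3P[pa' pb' _] d_gt0 d'_gt0.
  by move=> /(durfee_join_inj d_gt0 d'_gt0 pa pb pa' pb')[-> -> ->].
- move=> [|[d [a b]] [|? ?]] [//= v _ d_gt0 rk wt].
  move: v => /and3P[pa pb _]; split; first exact: durfee_join_partition.
    by rewrite sumn_durfee_join // -wt !addn0.
  by rewrite rank_durfee_join.
- move=> la [la_part sum_la rk_la].
  have [|d [a [b [d_gt0 pa pb eq_la]]]] := durfee_join_surj la_part.
    by rewrite sum_la.
  exists [:: (d, (a, b))] => //; split=> //=.
  + by rewrite pa pb.
  + by rewrite -rk_la -eq_la rank_durfee_join.
  + by rewrite -sum_la -eq_la sumn_durfee_join // !addn0.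
Qed.

(** * The odd moments *)

Lemma eta_bar_oddE k n : 0 < k ->
  eta_bar_odd k n = \sum_(m < n.+1) diff2_kernel k m 0 * N (m : nat)%:Z%R n.
Proof.
case: k => // k _; rewrite /eta_bar_odd.
have F_eq0 m : 1 <= m -> m \notin iota 0 n.+1 ->
    'C(m + k.+1 - 1, 2 * k.+1 - 1) * N m%:Z%R n = 0.
  by rewrite mem_iota add0n -leqNgt => _ lt_nm; rewrite N_eq0 ?muln0.
transitivity (\sum_(m <- index_iota 0 n.+1 | 1 <= m)
    'C(m + k.+1 - 1, 2 * k.+1 - 1) * N m%:Z%R n).
  by rewrite /index_iota subn0 [RHS]bigfs ?iota_uniq.
rewrite big_mkord big_mkcond /=; apply: eq_bigr => -[m /= _] _.
rewrite subn0 !addnS subn1 /= mulnS subn1.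
(* The sum on the right also has the term m = 0, where the binomial vanishes. *)
by case: m => [|m] //=; rewrite bin_small //; lia.
Qed.

(** Gives all D a common range of summation, although the weight left for the chain is n - D^2. *)
Lemma nb_chains_closed_wide k D (j n M : nat) : n <= M ->
  nb_chains 1 k D j%:Z%R n =
  \sum_(m < M.+1) diff2_kernel k m j * nb_chains 1 0 D (m : nat)%:Z%R n.
Proof.
move=> le_nM; rewrite nb_chains_closed.
rewrite (big_ord_widen M.+1
  (fun m => diff2_kernel k m j * nb_chains 1 0 D m%:Z%R n)) //.
rewrite big_mkcond; apply: eq_bigr => m _; case: ltnP => // lt_nm.
by rewrite nb_chains_rank_gt // muln0.
Qed.

Theorem theorem2p1 (k i n : nat) (hk : 0 < k) (hi : 1 <= i <= k.+1)
    (hn : 0 < n) :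
  eta_bar_odd k n =
  count_set [set tau : symbol k.+1 |
    is_marked_durfee n tau /\ rho tau i = 0%R].
Proof.
rewrite count_marked_durfee // count_all_chains eta_bar_oddE //.
(* With the sum over D outermost, it remains to compare the two sides for each fixed D, by symmetry
   in the marked pair and the closed form at rank 0. *)
under eq_bigr => m _ do rewrite N_all_chains // count_all_chains big_distrr.
rewrite exchange_big /=; apply: eq_bigr => D _.
rewrite /shift; case: ifP => _; last by rewrite big1 // => m _; rewrite muln0.
by rewrite nb_chains_slot // (@nb_chains_closed_wide k D 0 _ n) // leq_subr.
Qed.
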